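(* Let $X,Y$ be indecomposable left quasigroups and let $p:X\to Y$ be an epimorphism. Then $p$ factorizes as $p=q\circ r$, where $r:X\to X/\mathcal{G}^{\sim_p}$ is the canonical projection and $q:X/\mathcal{G}^{\sim_p}\to Y$ is a covering of indecomposable left quasigroups.
   Context: A left quasigroup $(X,\cdot)$ is a non-empty set with a binary operation such that $\sigma_x:y\mapsto x\cdot y$ is bijective for every $x$. $\mathcal{G}(X)=\langle\sigma_x\mid x\in X\rangle\le \mathrm{Sym}(X)$, and $X$ is indecomposable if $\mathcal{G}(X)$ is transitive on $X$. A homomorphism is a map $p$ with $p(x\cdot y)=p(x)\cdot p(y)$; an epimorphism is a surjective homomorphism. An epimorphism $p:X\to Y$ induces a surjective group homomorphism $\bar p:\mathcal{G}(X)\to\mathcal{G}(Y)$ with $\bar p(\sigma_x)=\sigma_{p(x)}$. An epimorphism $p$ between indecomposable left quasigroups is a covering if $\bar p$ is an isomorphism. A congruence is an equivalence relation $\sim$ such that $x\sim x'$ and $y\sim y'$ imply $x\cdot y\sim x'\cdot y'$ and $\sigma_x^{-1}(y)\sim\sigma_{x'}^{-1}(y')$; the quotient $X/\!\sim$ is then a left quasigroup. For an epimorphism $p$, $\sim_p$ is the congruence $x\sim_p y\iff p(x)=p(y)$. For a congruence $\sim$, $\mathcal{G}^{\sim}=\{h\in\mathcal{G}(X): h(x)\sim x\text{ for every }x\in X\}$. The orbits of the normal subgroup $\mathcal{G}^{\sim}$ on $X$ are the classes of a congruence of $X$, and $X/\mathcal{G}^{\sim}$ denotes the quotient of $X$ by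 this congruence. *)

(* Defs.v *)
From HB Require Import structures.
From mathcomp Require Import all_boot.
From mathcomp Require Import boolp classical_sets.

Set Implicit Arguments.
Unset Strict Implicit.
Unset Printing Implicit Defensive.

Import Algebra.

Local Open Scope group_scope.
Local Open Scope quotient_scope.

(* Carriers are [choiceType]s, which costs no generality: [boolp.gen_eqMixin]
   and [boolp.gen_choiceMixin] equip an arbitrary type with that structure. *)

Section Symmetric.
Variable T : choiceType.

Record Sym := MkSym { Sym_fun : T -> T; _ : `[< bijective Sym_fun >] }.

HB.instance Definition _ := [isSub for Sym_fun].
HB.instance Definition _ := [Choice of Sym by <:].

Coercion Sym_fun : Sym >-> Funclass.

Lemma Sym_bij (f : Sym) : bijective f.
Proof. by case: f => f /= /asboolP. Qed.

Lemma Sym_eqP (f g : Sym) : f =1 g -> f = g.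
Proof. by move=> fg; apply/val_inj/funext. Qed.

Definition Sym_of (f : T -> T) (bf : bijective f) : Sym := MkSym (asboolT bf).

Lemma Sym_inv_ex (f : Sym) : exists g : Sym, cancel f g /\ cancel g f.
Proof. by case: (Sym_bij f) => g fK gK; exists (Sym_of (Bijective gK fK)). Qed.

Definition Sym_inv (f : Sym) : Sym := sval (cid (Sym_inv_ex f)).
Definition Sym_one : Sym := Sym_of (Bijective (frefl id) (frefl id)).
Definition Sym_mul (f g : Sym) : Sym := Sym_of (bij_comp (Sym_bij f) (Sym_bij g)).

Lemma Sym_invK (f : Sym) : cancel f (Sym_inv f).
Proof. by rewrite /Sym_inv; case: cid => g []. Qed.

Lemma Sym_Kinv (f : Sym) : cancel (Sym_inv f) f.
Proof. by rewrite /Sym_inv; case: cid => g []. Qed.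

Fact Sym_mulA : associative Sym_mul. Proof. by move=> f g h; apply: Sym_eqP. Qed.
Fact Sym_mul1 : left_id Sym_one Sym_mul. Proof. by move=> f; apply: Sym_eqP. Qed.
Fact Sym_mulr1 : right_id Sym_one Sym_mul. Proof. by move=> f; apply: Sym_eqP. Qed.
Fact Sym_mulV : left_inverse Sym_one Sym_inv Sym_mul.
Proof. by move=> f; apply: Sym_eqP => x /=; apply: Sym_invK. Qed.
Fact Sym_mulrV : right_inverse Sym_one Sym_inv Sym_mul.
Proof. by move=> f; apply: Sym_eqP => x /=; apply: Sym_Kinv. Qed.

HB.instance Definition _ :=
  isGroup.Build Sym Sym_mulA Sym_mul1 Sym_mulr1 Sym_mulV Sym_mulrV.

Lemma SymM (f g : Sym) x : (f * g) x = f (g x). Proof. by []. Qed.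
Lemma Sym1 x : (1 : Sym) x = x. Proof. by []. Qed.
Lemma SymK (f : Sym) : cancel f f^-1. Proof. exact: Sym_invK. Qed.
Lemma SymVK (f : Sym) : cancel f^-1 f. Proof. exact: Sym_Kinv. Qed.

End Symmetric.

Section Generated.
Variables (G : groupType) (A : set G).

(* The smallest subgroup of G containing A. *)
Definition generated : {pred G} :=
  [pred g | `[< forall H : {pred G},
    group_closed H -> (forall a, A a -> a \in H) -> g \in H >]].

Lemma generated_closed : group_closed generated.
Proof.
split=> [|g h /asboolP gP /asboolP hP]; first by apply/asboolP => H [].
apply/asboolP => H HH AH; have [_ Hdiv] := HH.
by apply: Hdiv; [apply: gP | apply: hP].
Qed.

Lemma mem_generated a : A a -> a \in generated.
Proof. by move=> Aa; apply/asboolP => H _; apply. Qed.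

End Generated.

HB.mixin Record isLeftQuasigroup X of Choice X := {
  lqop : X -> X -> X;
  lqop_bij : forall x, bijective (lqop x);
  lq_nonempty : inhabited X
}.

#[short(type="leftQuasigroupType")]
HB.structure Definition LeftQuasigroup := {X of isLeftQuasigroup X & Choice X}.

Declare Scope lq_scope.
Delimit Scope lq_scope with LQ.
Notation "x ** y" := (lqop x y) (at level 40, left associativity) : lq_scope.
Local Open Scope lq_scope.

Section LeftMultiplicationGroup.
Variable X : leftQuasigroupType.

Definition sigma (x : X) : Sym X := Sym_of (lqop_bij x).

Lemma sigmaE (x y : X) : sigma x y = x ** y. Proof. by []. Qed.

(* The group G(X) generated by the left translations. *)
Record mlt := MkMlt {
  mlt_val : Sym X;
  _ : mlt_val \in generated (range sigma)
}.

HB.instance Definition _ := [isSub for mlt_val].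
HB.instance Definition _ := [Choice of mlt by <:].
HB.instance Definition _ :=
  SubChoice_isSubGroup.Build _ _ mlt (@generated_closed (Sym X) (range sigma)).

Coercion mlt_val : mlt >-> Sym.

Definition mlt_sigma (x : X) : mlt := MkMlt (mem_generated (imageT sigma x)).

Lemma mlt_eqP (g h : mlt) : g =1 h -> g = h.
Proof. by move=> gh; apply/val_inj/Sym_eqP. Qed.

Lemma mlt1E (x : X) : (1 : mlt) x = x. Proof. by []. Qed.
Lemma mltME (g h : mlt) (x : X) : (g * h) x = g (h x). Proof. by []. Qed.
Lemma mltVE (g : mlt) : (g^-1 : mlt) = (g : Sym X)^-1 :> Sym X.
Proof. by []. Qed.
Lemma mltK (g : mlt) : cancel g g^-1. Proof. exact: SymK. Qed.
Lemma mltVK (g : mlt) : cancel g^-1 g. Proof. exact: SymVK. Qed.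

Lemma mlt_gen_ind (P : mlt -> Prop) :
  (forall x, P (mlt_sigma x)) -> P 1 ->
  (forall g h, P g -> P h -> P (g / h)) -> forall g, P g.
Proof.
move=> Ps P1 Pd g.
pose H : {pred Sym X} := [pred f | `[< exists2 k : mlt, val k = f & P k >]].
have HH : group_closed H.
  split=> [|f k /asboolP[f' <- Pf] /asboolP[k' <- Pk]].
    by apply/asboolP; exists 1.
  by apply/asboolP; exists (f' / k'); [|exact: Pd].
have /asboolP[k kg Pk] : val g \in H.
  case: g => g /= /asboolP; apply=> // _ [x _ <-].
  by apply/asboolP; exists (mlt_sigma x).
by rewrite -(val_inj kg).
Qed.

Definition indecomposable := forall x y : X, exists g : mlt, g x = y.

End LeftMultiplicationGroup.

Section Morphisms.
Variables X Y : leftQuasigroupType.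

Definition lq_morphism (p : X -> Y) := forall x y, p (x ** y) = p x ** p y.

Definition epimorphism (p : X -> Y) :=
  lq_morphism p /\ forall y, exists x, p x = y.

Lemma mlt_intertwine (p : X -> Y) (Hp : lq_morphism p) (g : mlt X) :
  exists h : mlt Y, forall x, p (g x) = h (p x).
Proof.
elim/mlt_gen_ind: g => [x||g h [g' Hg] [h' Hh]].
- by exists (mlt_sigma (p x)) => y; apply: Hp.
- by exists 1.
exists (g' / h') => x; rewrite !mltME Hg; congr (g' _).
by apply: (can_inj (mltK h')); rewrite mltVK -Hh mltVK.
Qed.

Lemma mlt_map_ex (p : X -> Y) (Hp : epimorphism p) :
  exists f : UMagmaMorphism.type (mlt X) (mlt Y),
    forall x, f (mlt_sigma x) = mlt_sigma (p x).
Proof.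
have [Hm Hs] := Hp.
pose f g := sval (cid (mlt_intertwine Hm g)).
have fP (g : mlt X) x : p (g x) = f g (p x) by rewrite /f; case: cid.
have eqY (g h : mlt Y) : (forall x, g (p x) = h (p x)) -> g = h.
  by move=> gh; apply: mlt_eqP => y; have [x <-] := Hs y.
have fM : monoid_morphism f.
  split=> [|g h]; apply: eqY => x; first by rewrite -fP.
  by rewrite -fP !mltME !fP.
pose F := isUMagmaMorphism.Build _ _ f fM.
pose fm : UMagmaMorphism.type _ _ := HB.pack f F.
by exists fm => x; apply: eqY => y; rewrite -fP; apply: Hm.
Qed.

(* The group morphism induced by p; [mlt_map_uniq] shows that the property it
   is chosen for determines it. *)
Definition mlt_map (p : X -> Y) (Hp : epimorphism p) :
  UMagmaMorphism.type (mlt X) (mlt Y) := sval (cid (mlt_map_ex Hp)).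

Lemma mlt_map_sigma (p : X -> Y) (Hp : epimorphism p) (x : X) :
  mlt_map Hp (mlt_sigma x) = mlt_sigma (p x).
Proof. by rewrite /mlt_map; case: cid. Qed.

Lemma mlt_map_uniq (p : X -> Y) (Hp : epimorphism p)
    (f : UMagmaMorphism.type (mlt X) (mlt Y)) :
  (forall x, f (mlt_sigma x) = mlt_sigma (p x)) -> f =1 mlt_map Hp.
Proof.
move=> Hf; elim/mlt_gen_ind => [x||g h Hg Hh].
- by rewrite Hf mlt_map_sigma.
- by rewrite !gmulf1.
- by rewrite !gmulfF Hg Hh.
Qed.

Definition covering (p : X -> Y) :=
  [/\ indecomposable X, indecomposable Y &
      exists Hp : epimorphism p, bijective (mlt_map Hp)].

End Morphisms.

Record congruence (X : leftQuasigroupType) := MkCongruence {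
  cong_rel :> equiv_rel X;
  cong_op : forall x x' y y' : X,
    cong_rel x x' -> cong_rel y y' -> cong_rel (x ** y) (x' ** y');
  cong_ldiv : forall x x' y y' : X,
    cong_rel x x' -> cong_rel y y' ->
    cong_rel ((sigma x)^-1 y) ((sigma x')^-1 y')
}.

Section Quotient.
Variables (X : leftQuasigroupType) (c : congruence X).

Definition lq_quot := {eq_quot c}.

HB.instance Definition _ := Choice.on lq_quot.
HB.instance Definition _ := EqQuotient.on lq_quot.

Definition lq_proj : X -> lq_quot := \pi_lq_quot.

Definition lq_quot_op (a b : lq_quot) : lq_quot :=
  lq_proj (repr a ** repr b).

Lemma lq_projP (x y : X) : reflect (lq_proj x = lq_proj y) (c x y).
Proof. exact: eqquotP. Qed.

Lemma lq_quot_opE (x y : X) :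
  lq_quot_op (lq_proj x) (lq_proj y) = lq_proj (x ** y).
Proof. by apply/lq_projP/cong_op; apply/lq_projP; rewrite /lq_proj reprK. Qed.

Lemma lq_quot_op_bij (a : lq_quot) : bijective (lq_quot_op a).
Proof.
pose d (b : lq_quot) := lq_proj ((sigma (repr a))^-1 (repr b)).
have reK b : lq_proj (repr b) = b by rewrite /lq_proj reprK.
exists d => b; rewrite /d.
- rewrite -[in RHS](reK b) -(SymK (sigma (repr a)) (repr b)).
  apply/lq_projP/cong_ldiv; first exact: equiv_refl.
  by apply/lq_projP; rewrite reK.
- rewrite -{1}(reK a) lq_quot_opE -[in RHS](reK b).
  by rewrite -{2}(SymVK (sigma (repr a)) (repr b)).
Qed.

Lemma lq_quot_nonempty : inhabited lq_quot.
Proof. by case: (@lq_nonempty X) => x; exists; apply: lq_proj. Qed.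

HB.instance Definition _ :=
  isLeftQuasigroup.Build lq_quot lq_quot_op_bij lq_quot_nonempty.

Lemma lq_proj_epi : epimorphism lq_proj.
Proof.
split=> [x y|a]; first by rewrite -lq_quot_opE.
by exists (repr a); rewrite /lq_proj reprK.
Qed.

End Quotient.

Section KernelCongruence.
Variables (X Y : leftQuasigroupType) (p : X -> Y) (Hp : epimorphism p).

Definition ker_rel : rel X := [rel x y | p x == p y].

Fact ker_rel_equiv : equiv_class_of ker_rel.
Proof.
split=> [x|x y|y x z]; rewrite /ker_rel /=; [exact: eqxx|exact: eq_sym|].
by move=> /eqP->.
Qed.

Definition ker_equiv := EquivRelPack ker_rel_equiv.

Fact ker_rel_op (x x' y y' : X) :
  ker_equiv x x' -> ker_equiv y y' -> ker_equiv (x ** y) (x' ** y').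
Proof.
by case: Hp => Hm _ /eqP xx' /eqP yy'; rewrite /= /ker_rel /= !Hm xx' yy'.
Qed.

Fact ker_rel_ldiv (x x' y y' : X) :
  ker_equiv x x' -> ker_equiv y y' ->
  ker_equiv ((sigma x)^-1 y) ((sigma x')^-1 y').
Proof.
case: Hp => Hm _ /eqP xx' /eqP yy'; apply/eqP.
apply: (bij_inj (Sym_bij (sigma (p x)))).
by rewrite sigmaE -Hm -sigmaE SymVK xx' sigmaE -Hm -sigmaE SymVK.
Qed.

Definition ker_cong : congruence X := MkCongruence ker_rel_op ker_rel_ldiv.

End KernelCongruence.

Section CongruenceKernelGroup.
Variables (X : leftQuasigroupType) (c : congruence X).

(* The subgroup of the h in G(X) with h(x) ~ x for all x; [orb_cong] is the
   congruence whose classes are its orbits. *)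
Definition mlt_ker : {pred mlt X} :=
  [pred h : mlt X | `[< forall x : X, c (h x) x >]].

Lemma mlt_kerP (h : mlt X) :
  reflect (forall x : X, c (h x) x) (h \in mlt_ker).
Proof. exact: asboolP. Qed.

Lemma cong_mlt (g : mlt X) (x y : X) : c x y -> c (g x) (g y).
Proof.
suff: (forall x y, c x y -> c (g x) (g y)) /\
      (forall x y, c x y -> c (g^-1 x) (g^-1 y)) by case=> + _; apply.
elim/mlt_gen_ind: g {x y} => [z||g h [Hg Hg'] [Hh Hh']].
- split=> x y xy; first by apply: cong_op => //; apply: equiv_refl.
  by rewrite mltVE; apply: cong_ldiv => //; apply: equiv_refl.
- by split=> x y; rewrite ?invg1.
split=> x y xy; first by rewrite !mltME; apply/Hg/Hh'.
by rewrite invgF !mltME; apply/Hh/Hg'.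
Qed.

Lemma mlt_ker_closed : group_closed mlt_ker.
Proof.
split=> [|g h /mlt_kerP gP /mlt_kerP hP]; apply/mlt_kerP => x.
  exact: equiv_refl.
rewrite mltME; apply: (equiv_trans (gP _)).
by rewrite -{2}(mltVK h x) equiv_sym hP.
Qed.

HB.instance Definition _ :=
  isMulClosed.Build _ mlt_ker (group_closedM mlt_ker_closed).
HB.instance Definition _ := isMul1Closed.Build _ mlt_ker mlt_ker_closed.1.
HB.instance Definition _ :=
  isInvClosed.Build _ mlt_ker (group_closedV mlt_ker_closed).

Lemma mlt_ker_normal (g h : mlt X) : h \in mlt_ker -> g * h / g \in mlt_ker.
Proof.
move=> /mlt_kerP hP; apply/mlt_kerP => x.
by rewrite !mltME -{2}(mltVK g x); apply: cong_mlt.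
Qed.

Definition orb_rel : rel X :=
  [rel x y | `[< exists2 h : mlt X, h \in mlt_ker & h x = y >]].

Lemma orb_relP (x y : X) :
  reflect (exists2 h : mlt X, h \in mlt_ker & h x = y) (orb_rel x y).
Proof. exact: asboolP. Qed.

Fact orb_rel_equiv : equiv_class_of orb_rel.
Proof.
have sym x y : orb_rel x y -> orb_rel y x.
  move=> /orb_relP[h hF <-]; apply/orb_relP.
  by exists h^-1; [rewrite gpredV | rewrite mltK].
split=> [x|x y|y x z /orb_relP[g gF <-] /orb_relP[h hF <-]].
- by apply/orb_relP; exists 1; [apply: gpred1|].
- by apply/idP/idP; apply: sym.
- by apply/orb_relP; exists (h * g); [apply: gpredM|].
Qed.

Definition orb_equiv := EquivRelPack orb_rel_equiv.

Lemma mlt_ker_sigma (h : mlt X) (x : X) : h \in mlt_ker ->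
  mlt_sigma (h x) / mlt_sigma x \in mlt_ker.
Proof.
move=> /mlt_kerP hP; apply/mlt_kerP => y; rewrite mltME.
rewrite -{2}(mltVK (mlt_sigma x) y).
by apply: cong_op => //; apply: equiv_refl.
Qed.

Fact orb_rel_op (x x' y y' : X) :
  orb_equiv x x' -> orb_equiv y y' -> orb_equiv (x ** y) (x' ** y').
Proof.
move=> /orb_relP[h hF <-] /orb_relP[k kF <-]; apply/orb_relP.
pose s := mlt_sigma x; pose t := mlt_sigma (h x).
exists (t / s * (s * k / s)).
  by apply: gpredM; [apply: mlt_ker_sigma | apply: mlt_ker_normal].
by rewrite !mltME -[x ** y]/(s y) !mltK.
Qed.

Fact orb_rel_ldiv (x x' y y' : X) :
  orb_equiv x x' -> orb_equiv y y' ->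
  orb_equiv ((sigma x)^-1 y) ((sigma x')^-1 y').
Proof.
move=> /orb_relP[h hF <-] /orb_relP[k kF <-]; apply/orb_relP.
pose s := mlt_sigma x; pose t := mlt_sigma (h x).
exists (t^-1 * (k * (t / s)^-1) / t^-1).
  apply: mlt_ker_normal; apply: gpredM => //.
  by rewrite gpredV; apply: mlt_ker_sigma.
rewrite invgK invgF !mltME -[(sigma x)^-1 y]/((s^-1 : mlt X) y).
by rewrite mltK mltVK.
Qed.

Definition orb_cong : congruence X := MkCongruence orb_rel_op orb_rel_ldiv.

End CongruenceKernelGroup.

(* Main.v *)
Require Import Defs.
From HB Require Import structures.
From mathcomp Require Import all_boot.
From mathcomp Require Import boolp classical_sets.

(* The map q induced by p on orbits is an epimorphism, so G(q) is onto.  If G(q)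
   kills g, lift g to h in G(X): then p (h x) = p x for every x, that is, h lies
   in the kernel group of ~_p, whose orbits are the points of the quotient;
   hence h acts trivially on the quotient and g = 1. *)

Set Implicit Arguments.
Unset Strict Implicit.
Unset Printing Implicit Defensive.

Import Algebra.

Local Open Scope group_scope.

Section InducedGroupMorphism.
Variables (X Y : leftQuasigroupType) (p : X -> Y) (Hp : epimorphism p).

(** [mlt_map] is specified only on left translations; since it respects products and inverses, its
    action on points follows by induction on generators. *)
Lemma mlt_mapE (g : mlt X) (x : X) : p (g x) = mlt_map Hp g (p x).
Proof.
elim/mlt_gen_ind: g x => [z||g h Hg Hh] x.
- by rewrite mlt_map_sigma; apply: Hp.1.
- by rewrite gmulf1.
rewrite gmulfF !mltME Hg; congr (mlt_map Hp g _).
(* For the inverse, write [x] as [h (h^-1 x)] and use the case of [h] at [h^-1 x]. *)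
by rewrite -{2}(mltVK h x) Hh mltK.
Qed.

Lemma mlt_map_surj (h : mlt Y) : exists g, mlt_map Hp g = h.
Proof.
elim/mlt_gen_ind: h => [y||_ _ [g <-] [h <-]].
- by have [x <-] := Hp.2 y; exists (mlt_sigma x); apply: mlt_map_sigma.
- by exists 1; apply: gmulf1.
- by exists (g / h); apply: gmulfF.
Qed.

Lemma indecomposable_epi : indecomposable X -> indecomposable Y.
Proof.
move=> HX y y'; have [[x <-] [x' <-]] := (Hp.2 y, Hp.2 y').
by have [g <-] := HX x x'; exists (mlt_map Hp g); rewrite mlt_mapE.
Qed.

Lemma mlt_map_bij :
  (forall g : mlt X, mlt_map Hp g = 1 -> g = 1) -> bijective (mlt_map Hp).
Proof.
move=> /gmulf_inj inj.
pose f h := sval (cid (mlt_map_surj h)).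
have fK : cancel f (mlt_map Hp) by move=> h; rewrite /f; case: cid.
by exists f => // g; apply: inj; rewrite fK.
Qed.

End InducedGroupMorphism.

(** Elements of the kernel of G(q) are tested on lifts to G(X), so the hypothesis mentions only the
    action on [X]. *)
Lemma covering_factor (X Q Y : leftQuasigroupType) (HX : indecomposable X)
    (r : X -> Q) (Hr : epimorphism r) (q : Q -> Y) (Hq : epimorphism q) :
  (forall h : mlt X, (forall x, q (r (h x)) = q (r x)) ->
     forall x, r (h x) = r x) ->
  covering q.
Proof.
move=> ker; have HQ := indecomposable_epi Hr HX.
split=> //; first exact: indecomposable_epi Hq HQ.
exists Hq; apply: mlt_map_bij => g qg1; have [h hg] := mlt_map_surj Hr g.
apply: mlt_eqP => a; have [x <-] := Hr.2 a.
by rewrite -hg -mlt_mapE ker // => z; rewrite !mlt_mapE hg qg1.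
Qed.

Lemma epimorphism_factor (X Q Y : leftQuasigroupType) (r : X -> Q) (q : Q -> Y) :
  epimorphism r -> epimorphism (q \o r) -> epimorphism q.
Proof.
move=> [rM rS] [pM pS]; split=> [a b|y]; last first.
  by have [x <-] := pS y; exists (r x).
have [[x <-] [y <-]] := (rS a, rS b).
by rewrite -rM; apply: pM.
Qed.

Theorem theorem6 (X Y : leftQuasigroupType)
  (HX : indecomposable X) (HY : indecomposable Y)
  (p : X -> Y) (Hp : epimorphism p) :
  exists q : lq_quot (orb_cong (ker_cong Hp)) -> Y,
    p = q \o lq_proj (orb_cong (ker_cong Hp)) /\
    covering q.
Proof.
set c := orb_cong _; pose q (a : lq_quot c) := p (repr a).
have pE : p = q \o lq_proj c.
  apply: funext => x; rewrite /q /=.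
  (* The chosen representative of the class of [x] is moved to [x] by some [h] in the kernel group,
     and such an [h] preserves the fibres of [p]. *)
  have /lq_projP/orb_relP[h /mlt_kerP hP hx] :
    lq_proj c (repr (lq_proj c x)) = lq_proj c x by rewrite /lq_proj reprK.
  by rewrite -[in LHS]hx; apply/eqP/hP.
exists q; split=> //.
have Hr := lq_proj_epi c.
have Hq : epimorphism q by apply: (epimorphism_factor Hr); rewrite -pE.
apply: (covering_factor HX Hr Hq) => h hp x.
(* [h] itself witnesses that [x] and [h x] share an orbit. *)
apply/esym/lq_projP/orb_relP; exists h => //.
by apply/mlt_kerP => z; apply/eqP; rewrite pE; apply: hp.
Qed.
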